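(* For bivariate copulas $D$ and $E$, the following are equivalent: (i) $D\leq_{\partial_1S}E$; (ii) $D_\uparrow\leq_{lo}E_\uparrow$; (iii) $D_\downarrow\geq_{lo}E_\downarrow$.
   Context: A bivariate copula is a function $C:[0,1]^2\to[0,1]$ that is grounded, $2$-increasing and has uniform marginals. $\partial_1$ denotes the partial derivative with respect to the first component (defined almost everywhere in that component). Lower orthant order: $D\leq_{lo}E$ means $D(u,v)\leq E(u,v)$ for all $(u,v)\in[0,1]^2$; $D\geq_{lo}E$ means $E\leq_{lo}D$. Schur order for functions: for an integrable $h:(0,1)\to\mathbb{R}$, let $h^*$ denote its decreasing rearrangement, i.e. the essentially unique decreasing function with $\lambda(h^*\geq w)=\lambda(h\geq w)$ for all $w\in\mathbb{R}$, where $\lambda$ is Lebesgue measure on $(0,1)$. For integrable $f,g:(0,1)\to\mathbb{R}$, write $f\prec_S g$ if $\int_0^x f^*(t)\,dt\leq\int_0^x g^*(t)\,dt$ for all $x\in(0,1)$ and $\int_0^1 f^*(t)\,dt=\int_0^1 g^*(t)\,dt$. Schur order for copula derivatives with respect to the first component: $D\leq_{\partial_1 S}E$ if $\partial_1 D(\cdot,v)\prec_S\partial_1E(\cdot,v)$ for all $v\in(0,1)$. Rearranged copulas: for a bivariate copula $E$, let $\mathcal{C}^E$ be the set of all bivariate copulas $C$ with $C\leq_{\partial_1S}E$. It is known that $\mathcal{C}^E$ has a unique minimal element $E_\downarrow\in\mathcal{C}^E$ and a unique maximal element $E_\uparrow\in\mathcal{C}^E$ in the lower orthant order, i.e. $E_\downarrow\leq_{lo}C\leq_{lo}E_\uparrow$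 for all $C\in\mathcal{C}^E$. These define $E_\downarrow$ and $E_\uparrow$ (and likewise $D_\downarrow,D_\uparrow$). *)

(* Defs.v *)
From mathcomp Require Import all_boot all_order all_algebra.
From mathcomp Require Import all_classical all_reals all_analysis.

Set Implicit Arguments.
Unset Strict Implicit.
Unset Printing Implicit Defensive.

Import Order.TTheory GRing.Theory Num.Theory.
Import numFieldNormedType.Exports.

Local Open Scope classical_set_scope.
Local Open Scope ring_scope.

Section Copulas.
Context {R : realType}.
Implicit Types (f g h : R -> R) (C D E : R -> R -> R).

Local Notation lambda := (@lebesgue_measure R).

(* A bivariate copula is represented by a total function R -> R -> R, of which
   only the values on [0, 1]^2 are constrained. *)
Definition copula C : Prop :=
  [/\ forall u v, 0 <= u <= 1 -> 0 <= v <= 1 -> 0 <= C u v <= 1,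
      forall t, 0 <= t <= 1 -> C t 0 = 0 /\ C 0 t = 0,
      forall t, 0 <= t <= 1 -> C t 1 = t /\ C 1 t = t &
      forall u1 u2 v1 v2, 0 <= u1 -> u1 <= u2 -> u2 <= 1 ->
        0 <= v1 -> v1 <= v2 -> v2 <= 1 ->
        0 <= C u2 v2 - C u2 v1 - C u1 v2 + C u1 v1].

Definition le_lo D E : Prop :=
  forall u v, 0 <= u <= 1 -> 0 <= v <= 1 -> D u v <= E u v.

(* [derive1] takes a default value where the derivative does not exist; for a
   copula this happens, at fixed v, only for u in a null set. *)
Definition partial1 C (u v : R) : R := derive1 (fun t => C t v) u.

Definition is_decr_rearr h (hs : R -> R) : Prop :=
  (forall s t, 0 < s -> s <= t -> t < 1 -> hs t <= hs s) /\
  (forall w : R, lambda [set t | 0 < t < 1 /\ w <= hs t] =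
                 lambda [set t | 0 < t < 1 /\ w <= h t]).

(* The decreasing rearrangement h^* of an integrable h on (0, 1).  It is only
   essentially unique, so that one representative is chosen. *)
Definition decr_rearr h : R -> R := xget h [set hs | is_decr_rearr h hs].

(* Meant for f and g integrable on (0, 1), as the partial derivatives of copulas
   are. *)
Definition schur_le f g : Prop :=
  (forall x : R, 0 < x < 1 ->
    \int[lambda]_(t in `]0, x[) decr_rearr f t
      <= \int[lambda]_(t in `]0, x[) decr_rearr g t) /\
  \int[lambda]_(t in `]0, 1[) decr_rearr f t
    = \int[lambda]_(t in `]0, 1[) decr_rearr g t.

Definition le_d1S D E : Prop :=
  forall v, 0 < v < 1 -> schur_le (partial1 D ^~ v) (partial1 E ^~ v).

Definition copulas_below E : set (R -> R -> R) :=
  [set C | copula C /\ le_d1S C E].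

(* The rearranged copulas are the least and the greatest element of
   [copulas_below E] for [le_lo].  They are unique on [0, 1]^2, and one of the
   total functions representing them is chosen. *)
Definition rearr_down E : R -> R -> R :=
  xget E [set M | copulas_below E M /\
                  forall C, copulas_below E C -> le_lo M C].

Definition rearr_up E : R -> R -> R :=
  xget E [set M | copulas_below E M /\
                  forall C, copulas_below E C -> le_lo C M].

End Copulas.

(* Main.v *)
Require Import Defs.
From HB Require Import structures.
From mathcomp Require Import all_boot all_order all_algebra.
From mathcomp Require Import all_classical all_reals all_analysis.
From mathcomp Require Import measurable_realfun lra.

(* Each section C(., v) of a copula is nondecreasing and 1-Lipschitz, hence an
   indefinite integral of its derivative h, which takes values in [0, 1].  By the
   layer-cake formula, with d(w) the measure of {h >= w}, the integral of h^* over
   (0, x) is U(x, v), the integral of min(x, d(w)) over w in [0, 1].  The function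
   U is a copula, because h increases with v; d_1 U(., v) is h^* almost everywhere,
   so that U belongs to the set C^C; and C <= U, because the part of {h >= w} in
   (0, x) has measure at most min(x, d(w)).  Hence U = C_up, the relation
   D <=_{d_1 S} E says exactly that D_up <= E_up, and reversing the first
   coordinate, which preserves distributions, yields
   C_down(u, v) = v - C_up(1 - u, v). *)

Section RearrangedCopulas.

Set Implicit Arguments.
Unset Strict Implicit.
Unset Printing Implicit Defensive.
Import Order.TTheory GRing.Theory Num.Theory.
Import numFieldNormedType.Exports.
Local Open Scope classical_set_scope.
Local Open Scope ring_scope.

Context {R : realType}.
Implicit Types (f g h hs fs : R -> R) (C D E : R -> R -> R).
Local Notation lambda := (@lebesgue_measure R).

(** * Distribution functions on (0, 1) and outer measure *)

Definition tail h (w : R) : R :=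
  fine (lambda [set t | 0 < t < 1 /\ w <= h t]).

(* The layer-cake form of the integral of the decreasing rearrangement of [h]
   over [(0, x)]: it depends on [h] only through [tail h]. *)
Definition rearr_int h (x : R) : R :=
  \int[lambda]_(w in `[0, 1]) Num.min x (tail h w).

(** A derivative given by [derive1] has default values where it does not exist; a Borel
    representative with values in [0, 1] everywhere stands in for it in integrals. *)
Definition unit_version h f : Prop :=
  [/\ measurable_fun setT f, forall t, 0 <= f t <= 1 &
      lambda.-negligible [set t | 0 < t < 1 /\ h t <> f t]].

(* [lebesgue_measure] is the Lebesgue outer measure, also outside the Borel
   sets. *)
Lemma le_lambda (A B : set R) : A `<=` B -> (lambda A <= lambda B)%E.
Proof. exact: (@le_mu_ext _ _ _ (wlength (R:=R) idfun)). Qed.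

Lemma lambda_negligible (N : set R) : lambda.-negligible N -> lambda N = 0%E.
Proof.
move=> [M [mM M0 NM]]; apply/eqP; rewrite eq_le -{1}M0 le_lambda//.
exact: mu_ext_ge0.
Qed.

(** Subadditivity of the outer measure. It allows comparing superlevel sets of functions known only
    almost everywhere. *)
Lemma le_lambda_negligible (A B N : set R) : lambda.-negligible N ->
  A `<=` B `|` N -> (lambda A <= lambda B)%E.
Proof.
move=> /lambda_negligible N0 /le_lambda/le_trans; apply.
rewrite -[leRHS]adde0 -N0.
exact: (@outer_measureU2 _ _ (mu_ext (wlength (R:=R) idfun))).
Qed.

Lemma lambda_oo (a b : R) : a <= b -> lambda `]a, b[ = (b - a)%:E.
Proof.
rewrite lebesgue_measure_itv /= lte_fin le_eqVlt => /predU1P[->|->//].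
by rewrite ltxx subrr.
Qed.

Lemma lambda_sub_oo (A : set R) a b : a <= b -> A `<=` `]a, b[ ->
  lambda A \is a fin_num /\ 0 <= fine (lambda A) <= b - a.
Proof.
move=> ab /le_lambda; rewrite lambda_oo// => Ale.
have A0 : (0 <= lambda A)%E by exact: mu_ext_ge0.
have Af : lambda A \is a fin_num.
  by rewrite ge0_fin_numE//; apply: le_lt_trans Ale _; rewrite ltry.
by split => //; rewrite fine_ge0//= -lee_fin fineK.
Qed.

Lemma tail_fin h w :
  lambda [set t | 0 < t < 1 /\ w <= h t] = (tail h w)%:E.
Proof.
rewrite /tail fineK//; apply: (@lambda_sub_oo _ 0 1 _ _).1 => // t /= [].
by rewrite in_itv.
Qed.

Lemma tail_bounds h w : 0 <= tail h w <= 1.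
Proof.
have [|_] := @lambda_sub_oo [set t | 0 < t < 1 /\ w <= h t] 0 1 ler01.
  by move=> t /= []; rewrite in_itv.
by rewrite subr0.
Qed.

Lemma le_tail_negligible h1 h2 w :
  lambda.-negligible [set t | 0 < t < 1 /\ h2 t < h1 t] ->
  tail h1 w <= tail h2 w.
Proof.
move=> N; rewrite -lee_fin -!tail_fin; apply: (le_lambda_negligible N).
move=> t /= [t01 wh]; have [h12|h21] := leP (h1 t) (h2 t).
  by left; split => //; exact: le_trans h12.
by right.
Qed.

Lemma tail_version h f : unit_version h f -> tail h = tail f.
Proof.
move=> [_ _ N]; apply/funext => w; apply/eqP; rewrite eq_le.
by apply/andP; split; apply: le_tail_negligible; apply: negligibleS N;
  move=> t /= [t01 /eqP]; rewrite lt_neqAle => /eqP/andP[/eqP ne _];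
  split => // /esym.
Qed.

Lemma tail_nonincreasing h : {homo tail h : w1 w2 / w1 <= w2 >-> w2 <= w1}.
Proof.
move=> w1 w2 w12; rewrite -lee_fin -!tail_fin; apply: le_lambda.
by move=> t /= [-> /(le_trans w12)].
Qed.

Lemma integrable_unit (a b : R) f : measurable_fun setT f ->
  (forall t, 0 <= f t <= 1) -> lambda.-integrable `]a, b[ (EFin \o f).
Proof.
move=> mf f01; apply: measurable_bounded_integrable => //.
- by rewrite /= lebesgue_measure_itv/=; case: ifP => _; rewrite -?EFinB ltry.
- exact: measurable_funTS.
- exists 1; split => // M M1 t _ /=; have /andP[f0 f1] := f01 t.
  by rewrite ger0_norm// (le_trans f1)// ltW.
Qed.

Lemma integrable_min_tail h x : 0 <= x <= 1 ->
  lambda.-integrable `[0, 1] (EFin \o (fun w => Num.min x (tail h w))).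
Proof.
move=> /andP[x0 x1]; apply: measurable_bounded_integrable => //.
- by rewrite /= lebesgue_measure_itv/=; case: ifP => _; rewrite -?EFinB ltry.
- apply: nonincreasing_measurable => // w1 w2 w12.
  by rewrite le_min !ge_min lexx /= tail_nonincreasing ?orbT.
- exists 1; split => // M M1 t _ /=; have /andP[f0 f1] := tail_bounds h t.
  by rewrite ger0_norm ?le_min ?x0// ge_min (le_trans x1)// ltW.
Qed.

(** * Layer-cake formula and decreasing rearrangement *)

(** Tonelli for the region [A] under the graph of [f]: the section at [t] is [0, f t], of length
    [f t], and the section at height [w] is the superlevel set in (a, b). *)
Lemma layer_cake f (a b : R) : a <= b -> measurable_fun setT f ->
  (forall t, 0 <= f t <= 1) ->
  \int[lambda]_(t in `]a, b[) f t =
  \int[lambda]_(w in `[0, 1]) fine (lambda [set t | a < t < b /\ w <= f t]).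
Proof.
move=> ab mf f01; rewrite /Rintegral; congr fine.
pose T2 := (measurableTypeR R * measurableTypeR R)%type.
pose A : set T2 := [set p | (a < p.1 < b /\ p.2 <= f p.1) /\ 0 <= p.2 <= 1].
have mA : measurable A.
  have mfst : measurable_fun setT (fst : T2 -> R) by exact: measurable_fst.
  have msnd : measurable_fun setT (snd : T2 -> R) by exact: measurable_snd.
  have mB (B : T2 -> bool) : measurable_fun setT B -> measurable [set p | B p].
    by move=> /(_ measurableT [set true]); rewrite setTI; exact.
  have mA1 : measurable_fun setT (fun p : T2 => a < p.1 < b).
    by apply: measurable_and; exact: measurable_fun_ltr.
  have mA2 : measurable_fun setT (fun p : T2 => p.2 <= f p.1).
    by apply: (@measurable_fun_ler _ _ _ _ snd (f \o fst)) => //;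
      exact: measurableT_comp.
  have mA3 : measurable_fun setT (fun p : T2 => 0 <= p.2 <= 1).
    by apply: measurable_and; exact: measurable_fun_ler.
  apply: (@measurableI _ _ (_ `&` _)); first apply: measurableI.
  - exact: mB mA1.
  - exact: mB mA2.
  - exact: mB mA3.
transitivity (\int[lambda]_t lambda (xsection A t))%E.
  rewrite integral_mkcond; apply: eq_integral => t _.
  rewrite patchE; case: ifPn => [|].
    rewrite inE/= in_itv/= => tab; have /andP[f0 f1] := f01 t.
    rewrite (_ : xsection A t = `[0, f t]%classic).
      rewrite lebesgue_measure_itv/= lte_fin.
      by case: ltgtP f0 => // [_ _|<- //]; rewrite sube0.
    apply/seteqP; split => w; rewrite /xsection/= inE /A/= in_itv/=.
      by move=> [[_ ->] /andP[->]].
    by move=> /andP[w0 wf]; rewrite tab wf w0 (le_trans wf).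
  rewrite notin_setE/= in_itv/= => tab.
  rewrite (_ : xsection A t = set0) ?measure0//.
  by apply/seteqP; split => // w; rewrite /xsection/= inE /A/= => -[[]].
transitivity (\int[lambda]_w lambda (ysection A w))%E; last first.
  rewrite [RHS]integral_mkcond; apply: eq_integral => w _.
  rewrite patchE; case: ifPn => [|].
    rewrite inE/= in_itv/= => w01.
    rewrite fineK; last by apply: (lambda_sub_oo ab _).1 => t /= []; rewrite in_itv.
    congr (lambda _); apply/seteqP; split => t; rewrite /ysection/= inE /A/=.
      by move=> [].
    by [].
  rewrite notin_setE/= in_itv/= => w01.
  rewrite (_ : ysection A w = set0) ?measure0//.
  by apply/seteqP; split => // t; rewrite /ysection/= inE /A/= => -[].
have := @indic_fubini_tonelli _ _ (measurableTypeR R) (measurableTypeR R) R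
  lambda lambda A mA.
by rewrite indic_fubini_tonelli_FE// indic_fubini_tonelli_GE.
Qed.

Lemma eq_tail h1 h2 : (forall t, 0 < t < 1 -> h1 t = h2 t) ->
  tail h1 = tail h2.
Proof.
move=> h12; apply/funext => w; congr (fine (lambda _)).
by apply/seteqP; split => t /= [t01]; rewrite h12.
Qed.

Lemma tail_le0 h f w : unit_version h f -> w <= 0 -> tail h w = 1.
Proof.
move=> vh w0; rewrite (tail_version vh); case: vh => _ f01 _; rewrite /tail.
rewrite (_ : [set _ | _] = `]0, 1[%classic) ?lambda_oo ?subr0//.
apply/seteqP; split => t /=; rewrite in_itv/=; first by case.
by move=> ->; split => //; have /andP[/(le_trans w0)] := f01 t.
Qed.

Lemma tail_gt1 h f w : unit_version h f -> 1 < w -> tail h w = 0.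
Proof.
move=> vh w1; rewrite (tail_version vh); case: vh => _ f01 _; rewrite /tail.
rewrite (_ : [set _ | _] = set0) ?measure0//.
apply/seteqP; split => t //= [_ wf]; have /andP[_ f1] := f01 t.
by have := lt_le_trans w1 (le_trans wf f1); rewrite ltxx.
Qed.

Lemma measurable_superlevel f w (a b : R) : measurable_fun setT f ->
  measurable [set t | a < t < b /\ w <= f t].
Proof.
move=> mf; rewrite (_ : [set _ | _] = `]a, b[ `&` (f @^-1` `[w, +oo[)).
  apply: measurableI => //; rewrite -[_ @^-1` _]setTI.
  by apply: mf => //; exact: measurable_itv.
by apply/seteqP; split => t /=; rewrite !in_itv/= andbT.
Qed.

Lemma tail_decr_rearr h hs : is_decr_rearr h hs -> tail hs = tail h.
Proof. by move=> [_ hE]; apply/funext => w; rewrite /tail hE. Qed.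

(** The values of [hs] on (0, 1) lie in [0, 1] because its distribution is that of [f]; a monotone
    extension to the whole line is then Borel. *)
Lemma decr_rearr_borel h f hs : unit_version h f -> is_decr_rearr h hs ->
  exists fs, [/\ measurable_fun setT fs, forall t, 0 <= fs t <= 1,
    {homo fs : s t / s <= t >-> t <= s} &
    forall t, 0 < t < 1 -> fs t = hs t].
Proof.
move=> vh dh; have [hs_ni _] := dh; have thE := tail_decr_rearr dh.
have hs1 (t : R) : 0 < t < 1 -> hs t <= 1.
  move=> /andP[t0 t1]; rewrite leNgt; apply/negP => h1.
  (* By monotonicity [hs] is at least [hs t] on (0, t), so this tail is also at least [t], which is
     positive. *)
  have : tail hs (hs t) = 0 by rewrite thE (tail_gt1 vh).
  apply/eqP; rewrite gt_eqF// -lte_fin -tail_fin.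
  apply: (@lt_le_trans _ _ (lambda `]0, t[)).
    by rewrite lambda_oo ?subr0 ?lte_fin// ltW.
  apply: le_lambda => s /=; rewrite in_itv/= => /andP[s0 st].
  by rewrite s0 (lt_trans st t1) hs_ni// ltW.
have hs0 (t : R) : 0 < t < 1 -> 0 <= hs t.
  move=> /andP[t0 t1]; rewrite leNgt; apply/negP => h0.
  (* If [hs t] is negative, [hs] can be nonnegative only inside (0, t), so this tail is also at most
     [t], which is below 1. *)
  have : tail hs 0 = 1 by rewrite thE (tail_le0 vh).
  apply/eqP; rewrite lt_eqF// -lte_fin -tail_fin.
  apply: (@le_lt_trans _ _ (lambda `]0, t[)).
    apply: le_lambda => s /= [/andP[s0 s1] hs_ge0]; rewrite in_itv/= s0.
    by rewrite ltNge; apply/negP => ts; have := hs_ni t s t0 ts s1; lra.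
  by rewrite lambda_oo ?subr0 ?lte_fin// ltW.
(* The extreme values 1 on the left and 0 on the right keep the extension nonincreasing. *)
pose fs (t : R) : R := if t <= 0 then 1 else if 1 <= t then 0 else hs t.
have fs01 (t : R) : 0 <= fs t <= 1.
  rewrite /fs; case: (leP t 0) => [|t0]; first by rewrite ler01 lexx.
  case: (leP 1 t) => [|t1]; first by rewrite ler01 lexx.
  by rewrite hs0 ?hs1// t0 t1.
have fs_ni : {homo fs : s t / s <= t >-> t <= s}.
  move=> s t st; rewrite {2}/fs; case: (leP s 0) => [_|s0].
    by have /andP[] := fs01 t.
  case: (leP 1 s) => [s1|s1]; rewrite /fs.
    by rewrite ifF ?ifT//; lra.
  rewrite ifF; last lra.
  case: (leP 1 t) => [_|t1]; last exact: hs_ni.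
  by apply: hs0; lra.
exists fs; split => //.
  exact: nonincreasing_measurable.
by move=> t /andP[t0 t1]; rewrite /fs !ifF//; lra.
Qed.

(** The superlevel sets of [fs] are initial intervals of (0, 1). Such a set either reaches [x] and
    covers (0, x), or lies entirely in (0, x); both times its part in (0, x) has measure
    [Num.min x (tail fs w)]. *)
Lemma int_nonincreasing h fs x : measurable_fun setT fs ->
  (forall t, 0 <= fs t <= 1) -> {homo fs : s t / s <= t >-> t <= s} ->
  0 <= x <= 1 -> \int[lambda]_(t in `]0, x[) fs t = rearr_int fs x.
Proof.
move=> mfs fs01 fs_ni /andP[x0 x1]; rewrite layer_cake//.
apply: eq_Rintegral => w _; apply: EFin_inj.
have sub_x : [set t | 0 < t < x /\ w <= fs t] `<=` `]0, x[.
  by move=> t /= []; rewrite in_itv.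
rewrite fineK; last exact: (lambda_sub_oo x0 sub_x).1.
have [[t [t01 wt xt]]|no] :=
    pselect (exists t, [/\ 0 < t < 1, w <= fs t & x <= t]).
- have E : [set t | 0 < t < x /\ w <= fs t] = `]0, x[%classic.
    apply/seteqP; split => // s /=; rewrite in_itv/= => sx; split => //.
    by apply: le_trans wt _; apply: fs_ni; lra.
  have xE : lambda `]0, x[ = x%:E by rewrite lambda_oo ?subr0.
  rewrite E xE; congr _%:E; rewrite min_l// -lee_fin -tail_fin -xE -E.
  by apply: le_lambda => s /= [sx wf]; split => //; lra.
- have E : [set t | 0 < t < x /\ w <= fs t] = [set t | 0 < t < 1 /\ w <= fs t].
    apply/seteqP; split => s /= [s01 ws]; split => //; first lra.
    have [xs|sx] := leP x s; last lra.
    by exfalso; apply: no; exists s.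
  rewrite E tail_fin min_r// -lee_fin -tail_fin -E.
  by rewrite -[x in leRHS]subr0 -lambda_oo//; apply: le_lambda.
Qed.

Lemma int_decr_rearr h f hs x : unit_version h f -> is_decr_rearr h hs ->
  0 <= x <= 1 -> \int[lambda]_(t in `]0, x[) hs t = rearr_int h x.
Proof.
move=> vh dh x01; have [fs [mfs fs01 fs_ni fsE]] := decr_rearr_borel vh dh.
transitivity (\int[lambda]_(t in `]0, x[) fs t).
  by apply: eq_Rintegral => t; rewrite inE/= in_itv/= => tx; rewrite fsE//; lra.
by rewrite int_nonincreasing// /rearr_int (eq_tail fsE) (tail_decr_rearr dh).
Qed.

(** The superlevel set at [w] is the decreasing intersection of those at w - 1/(n+1), so continuity
    from above applies. *)
Lemma tail_left_continuous h f w t : unit_version h f ->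
  (forall w', w' < w -> t <= tail h w') -> t <= tail h w.
Proof.
move=> vh; rewrite (tail_version vh); case: vh => mf _ _ tle.
pose F n := [set s | 0 < s < 1 /\ w - n.+1%:R^-1 <= f s].
have mF n : measurable (F n) by exact: measurable_superlevel.
have FE : \bigcap_n F n = [set s | 0 < s < 1 /\ w <= f s].
  apply/seteqP; split => s /=.
    move=> Fs; split; first by have [] := Fs 0 I.
    apply/ler_addgt0Pl => e e0.
    have [n ne] : exists n, n.+1%:R^-1 < e.
      by have [n] := ltr_add_invr e0; rewrite add0r => ne; exists n.
    have [_] := Fs n I; move: ne; set r := _^-1 => ? ?; lra.
  move=> [s01 ws] n _; split => //; apply: le_trans ws.
  by rewrite gerBl invr_ge0.
have lF n : lambda (F n) = (tail f (w - n.+1%:R^-1))%:E by exact: tail_fin.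
have cv : lambda (F n) @[n --> \oo] --> (tail f w)%:E.
  rewrite -tail_fin -FE; apply: nonincreasing_cvg_mu => //.
  - by rewrite [ltLHS]lF ltry.
  - exact: bigcapT_measurable.
  - move=> m n mn; apply/subsetPset => s /= [s01 fs]; split => //.
    apply: le_trans fs; rewrite lerD2l lerN2 lef_pV2 ?posrE ?ltr0n//.
    by rewrite ler_nat.
rewrite -lee_fin -(cvg_lim _ cv)//; apply: lime_ge.
  by apply/cvg_ex; eexists; exact: cv.
by apply: nearW => n; rewrite lF lee_fin; apply: tle; rewrite gtrBl invr_gt0.
Qed.

Lemma lambda_le_oo (c : R) : 0 <= c <= 1 ->
  lambda [set t | 0 < t < 1 /\ t <= c] = c%:E.
Proof.
move=> /andP[c0 c1]; apply/eqP; rewrite eq_le; apply/andP; split.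
  have -> : c%:E = lambda `]0, c].
    rewrite lebesgue_measure_itv/= lte_fin.
    by case: ltgtP c0 => // [_|<-]; rewrite ?sube0.
  by apply: le_lambda => t /= [/andP[t0 _] tc]; rewrite in_itv/= t0.
have -> : c%:E = lambda `]0, c[ by rewrite lambda_oo// subr0.
apply: le_lambda => t /=; rewrite in_itv/= => /andP[t0 tc].
by rewrite t0 (lt_le_trans tc c1) ltW.
Qed.

(** The witness is the generalized inverse of [tail h]. By left continuity, [w <= hs t] is
    equivalent to [t <= tail h w] on (0, 1), so the superlevel set at [w] has measure [tail h w]. *)
Lemma decr_rearr_exists h f : unit_version h f -> exists hs, is_decr_rearr h hs.
Proof.
move=> vh.
pose S t := [set w | 0 <= w <= 1 /\ t <= tail h w].
have S0 t : t < 1 -> S t 0.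
  by move=> t1; split; [lra|rewrite (tail_le0 vh)// ltW].
have Sub t : ubound (S t) 1 by move=> w /= [/andP[]].
have supS t : t < 1 -> has_sup (S t).
  by move=> t1; split; [exists 0; exact: S0|exists 1].
exists (fun t => sup (S t)); split.
  move=> s t s0 st t1; apply: le_sup.
  - move=> w /= [w01 tw]; exists w; split => //; split => //; exact: le_trans tw.
  - by exists 0; exact: S0.
  - by apply: supS; exact: le_lt_trans t1.
move=> w; rewrite [RHS]tail_fin -[RHS]lambda_le_oo ?tail_bounds//.
congr (lambda _); apply/seteqP; split => t /= [t01].
  move=> wS; split => //; apply: (tail_left_continuous vh) => w' w'w.
  have /andP[_ t1] := t01.
  have [] := @sup_adherent _ (S t) (w - w') _ (supS _ t1); first lra.
  move=> u [_ tu] uw; apply: le_trans tu _; apply: tail_nonincreasing.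
  lra.
move=> tw; split => //; have /andP[t0 t1] := t01.
have [w0|w0] := leP w 0.
  by apply: le_trans w0 _; apply: ub_le_sup; [exists 1|exact: S0].
apply: ub_le_sup; first by exists 1.
split => //; rewrite ltW//= leNgt; apply/negP => w1.
by move: tw; rewrite (tail_gt1 vh w1); lra.
Qed.

(** Existence makes the choice in [decr_rearr] a genuine rearrangement, and all rearrangements have
    the same integral over (0, x). *)
Lemma int_decr_rearr_sel h f x : unit_version h f -> 0 <= x <= 1 ->
  \int[lambda]_(t in `]0, x[) decr_rearr h t = rearr_int h x.
Proof.
move=> vh; apply: (int_decr_rearr vh).
exact: (xgetPex _ (decr_rearr_exists vh)).
Qed.

Lemma schur_leP h1 h2 f1 f2 : unit_version h1 f1 -> unit_version h2 f2 ->
  schur_le h1 h2 <->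
  (forall x, 0 < x < 1 -> rearr_int h1 x <= rearr_int h2 x) /\
  rearr_int h1 1 = rearr_int h2 1.
Proof.
move=> v1 v2.
have i1 x : 0 <= x <= 1 ->
    \int[lambda]_(t in `]0, x[) decr_rearr h1 t = rearr_int h1 x.
  exact: int_decr_rearr_sel v1.
have i2 x : 0 <= x <= 1 ->
    \int[lambda]_(t in `]0, x[) decr_rearr h2 t = rearr_int h2 x.
  exact: int_decr_rearr_sel v2.
have x01 (x : R) : 0 < x < 1 -> 0 <= x <= 1 by lra.
have i01 : 0 <= (1 : R) <= 1 by rewrite ler01 lexx.
rewrite /schur_le (i1 1 i01) (i2 1 i01).
split=> -[le12 eq12]; split; [|exact: eq12| |exact: eq12] => x x01'.
  by rewrite -(i1 x (x01 x x01')) -(i2 x (x01 x x01')); exact: le12.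
by rewrite (i1 x (x01 x x01')) (i2 x (x01 x x01')); exact: le12.
Qed.

(** The part of a superlevel set in (a, b) has measure at most [b - a] and at most the full tail;
    integrate over the level. *)
Lemma int_le_rearr_int h f a b : unit_version h f -> 0 <= a -> a <= b -> b <= 1 ->
  \int[lambda]_(t in `]a, b[) f t <= rearr_int h (b - a).
Proof.
move=> vh a0 ab b1; have [mf f01 _] := vh; rewrite layer_cake//.
rewrite /rearr_int (tail_version vh).
have tab w : 0 <= fine (lambda [set t | a < t < b /\ w <= f t]) <=
    Num.min (b - a) (tail f w).
  have sub_ab : [set t | a < t < b /\ w <= f t] `<=` `]a, b[.
    by move=> t /= []; rewrite in_itv.
  have [fin /andP[-> le_ba]] := lambda_sub_oo ab sub_ab.
  rewrite le_min le_ba/= -lee_fin fineK// -tail_fin.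
  by apply: le_lambda => t /= [tab wf]; split => //; lra.
have imin := @integrable_min_tail f (b - a).
apply: le_Rintegral => //; last 2 first.
- by apply: imin; lra.
- by move=> w _; have /andP[] := tab w.
apply: measurable_bounded_integrable => //.
- by rewrite /= lebesgue_measure_itv/=; case: ifP => _; rewrite -?EFinB ltry.
- apply: nonincreasing_measurable => // w1 w2 w12.
  have sub_ab w : [set t | a < t < b /\ w <= f t] `<=` `]a, b[.
    by move=> t /= []; rewrite in_itv.
  apply: fine_le; [exact: (lambda_sub_oo ab (sub_ab _)).1..|].
  by apply: le_lambda => t /= [-> /(le_trans w12)].
- exists 1; split => // M M1 w _ /=; have /andP[f0 f1] := tab w.
  rewrite ger0_norm// (le_trans f1)// ge_min (le_trans _ (ltW M1))//.
  by lra.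
Qed.

Lemma rearr_int1 h f : unit_version h f ->
  rearr_int h 1 = \int[lambda]_(t in `]0, 1[) f t.
Proof.
move=> vh; have [mf f01 _] := vh; rewrite layer_cake//.
rewrite /rearr_int (tail_version vh); apply: eq_Rintegral => w _.
by rewrite min_r//; have /andP[] := tail_bounds f w.
Qed.

(** The function min(x2, d) - min(x1, d) is nondecreasing in d. This is the source of the
    2-increasing property of [rearranged]. *)
Lemma rearr_int_mono2 h1 h2 x1 x2 : 0 <= x1 -> x1 <= x2 -> x2 <= 1 ->
  (forall w, tail h1 w <= tail h2 w) ->
  rearr_int h1 x2 - rearr_int h1 x1 <= rearr_int h2 x2 - rearr_int h2 x1.
Proof.
move=> x10 x12 x21 t12; have imin h x : 0 <= x <= 1 ->
  lambda.-integrable `[0, 1] (EFin \o (fun w => Num.min x (tail h w))).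
  exact: integrable_min_tail.
have x1_01 : 0 <= x1 <= 1 by lra.
have x2_01 : 0 <= x2 <= 1 by lra.
rewrite -!RintegralB//; [|exact: imin..].
apply: le_Rintegral => //.
- exact: (integrableB _ (imin h1 _ x2_01) (imin h1 _ x1_01)).
- exact: (integrableB _ (imin h2 _ x2_01) (imin h2 _ x1_01)).
- move=> w _; have := t12 w; rewrite !minElt.
  move: (tail h1 w) (tail h2 w) => d1 d2; move: x12; clear.
  by do ! case: ltP => ?; lra.
Qed.

(** * Monotone 1-Lipschitz functions as integrals of their derivatives *)

Lemma lipschitz_cumulative g :
  (forall x y, x <= y -> 0 <= g y - g x <= y - x) ->
  exists G : cumulative R R, G =1 g.
Proof.
move=> lip.
have nd : {homo g : x y / x <= y}.
  by move=> x y /lip; lra.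
have lipn x y : `|g x - g y| <= `|x - y|.
  have [xy|/ltW yx] := leP x y.
    have /andP[? ?] := lip _ _ xy.
    by rewrite (distrC (g x)) (distrC x) !ger0_norm; lra.
  by have /andP[? ?] := lip _ _ yx; rewrite !ger0_norm; lra.
have rc : forall x, g @ x^'+ --> g x.
  apply: right_continuousW => x.
  apply/cvgrPdist_le => e e0; near=> y.
  have : `|x - y| <= e.
    by near: y; apply: cvgr_dist_le => //; exact: cvg_id.
  exact: le_trans (lipn x y).
by exists (HB.pack g (isCumulative.Build R _ R g nd rc) : cumulative R R).
Unshelve. all: by end_near. Qed.

Lemma lebesgue_stieltjes_oc (G : cumulative R R) (a b : R) : a <= b ->
  lebesgue_stieltjes_measure G `]a, b] = (G b - G a)%:E.
Proof.
move=> ab; rewrite /lebesgue_stieltjes_measure /measure_extension.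
rewrite measurable_mu_extE/=; last exact: is_ocitv.
by rewrite wlength_itv_bnd.
Qed.

(* Both [g] and [x - g x] are nondecreasing and their Lebesgue-Stieltjes measures
   add up to the Lebesgue measure, which therefore dominates that of [g]. *)
Lemma lipschitz_density g :
  (forall x y, x <= y -> 0 <= g y - g x <= y - x) ->
  exists f, lambda.-integrable `]0, 1[ (EFin \o f) /\
    forall x, 0 <= x <= 1 -> g x = g 0 + \int[lambda]_(t in `]0, x[) f t.
Proof.
move=> lip; have [G GE] := lipschitz_cumulative lip.
have [K KE] : exists K : cumulative R R, K =1 (fun x => x - g x).
  by apply: lipschitz_cumulative => x y /lip; lra.
pose nu := lebesgue_stieltjes_measure G.
have nu_le (A : set (measurableTypeR R)) : measurable A -> (nu A <= lambda A)%E.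
  move=> mA.
  (* The sum of the two Stieltjes measures gives ]a, b] the mass b - a, hence is the Lebesgue
     measure by uniqueness. *)
  pose s : {measure set (measurableTypeR R) -> \bar R} :=
    measure_add nu (lebesgue_stieltjes_measure K).
  have sE B : s B = (nu B + lebesgue_stieltjes_measure K B)%E.
    exact: measure_addE.
  rewrite (@lebesgue_measure_unique _ s) => [||//].
    by rewrite sE leeDl.
  move=> _ [[a b] _ <-] /=; rewrite sE.
  have [ab|ba] := leP a b; last first.
    by rewrite set_itv_ge ?measure0 ?adde0// bnd_simp -leNgt ltW.
  rewrite [RHS](_ : _ = (G b - G a)%:E + (K b - K a)%:E)%E; last first.
    by congr (_ + _)%E; exact: lebesgue_stieltjes_oc.
  rewrite lebesgue_measure_itv/= lte_fin -EFinD !GE !KE.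
  by move: ab; rewrite le_eqVlt => /predU1P[->|->];
     rewrite ?ltxx -?EFinB; congr _%:E; lra.
have m01 : measurable (`]0, 1] : set (measurableTypeR R)) by exact: measurable_itv.
have nu01 : (nu [set` `]0%R, 1%R]] < +oo)%E.
  by rewrite /nu lebesgue_stieltjes_oc// ltry.
(* Restriction to ]0, 1] makes the measure finite, as a charge must be for Radon-Nikodym. *)
pose nu' : {charge set (measurableTypeR R) -> \bar R} :=
  charge_of_finite_measure (mfrestr m01 nu01).
have dom : nu' `<< lambda.
  apply/null_content_dominatesP => A mA A0; apply/eqP.
  rewrite -measure_le0 -A0 (le_trans _ (nu_le _ mA))//.
  by apply: le_measure; rewrite ?inE//; exact: measurableI.
pose f0 := Radon_Nikodym nu' lambda.
have f0fin t : f0 t \is a fin_num by exact: Radon_Nikodym_fin_num.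
have if0 : lambda.-integrable setT f0 by exact: Radon_Nikodym_integrable.
have f0E : EFin \o (fine \o f0) = f0.
  by apply/funext => t /=; rewrite fineK.
exists (fine \o f0); split.
  by rewrite f0E; exact: integrableS if0.
move=> x /andP[x0 x1]; rewrite Rintegral_itv_bndo_bndc; last first.
  by rewrite f0E; exact: integrableS if0.
have -> : \int[lambda]_(t in `]0, x]) (fine \o f0) t = fine (nu' `]0, x]%classic).
  rewrite (@Radon_Nikodym_integral _ _ _ nu' lambda _ dom)//; congr fine.
  by apply: eq_integral => t _; rewrite /= fineK.
rewrite /nu' /charge_of_finite_measure/= /mfrestr /mrestr/=.
rewrite setIidl; last by apply: subset_itvl; rewrite bnd_simp.
by rewrite /nu lebesgue_stieltjes_oc//= !GE; lra.
Qed.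

(** Lebesgue differentiation for the extension of [f] by zero; near a point of (0, 1) its primitive
    is [g] up to the constant [g 0]. *)
Lemma primitive_derivable f g : lambda.-integrable `]0, 1[ (EFin \o f) ->
  (forall x, 0 <= x <= 1 -> g x = g 0 + \int[lambda]_(t in `]0, x[) f t) ->
  lambda.-negligible
    [set t | 0 < t < 1 /\ ~ (derivable g t 1 /\ derive1 g t = f t)].
Proof.
move=> intf gE; pose fr := f \_ `]0, 1[.
have locf : locally_integrable setT fr by exact: integrable_locally.
have intfr (y : R) : lambda.-integrable `]0, y] (EFin \o fr).
  apply: (integrableS measurableT) => //.
  rewrite -restrict_EFin.
  exact: (@integrable_mkcond _ _ _ lambda `]0, 1[%classic (EFin \o f)
    (measurable_itv _)).1 intf.
have := @FTC1 _ fr (BRight 0) intfr locf.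
apply: negligibleS => t /= [/andP[t0 t1] nd] FTC.
have [|] := FTC; first by rewrite lte_fin.
set F := (fun x : R => \int[lambda]_(s in `]0, x]) fr s) => dF F'.
have gF : {near t, F =1 (fun x => g x - g 0)}.
  have : t \in `]0, 1[ by rewrite in_itv/= t0.
  move/near_in_itvoo; apply: filterS => y; rewrite in_itv/= => /andP[y0 y1].
  rewrite gE; last by rewrite !ltW.
  rewrite addrAC subrr add0r /F -Rintegral_itv_bndo_bndc//; last first.
    by apply: integrableS (intfr y) => //; apply: subset_itvl; rewrite bnd_simp.
  apply: eq_Rintegral => s; rewrite inE/= in_itv/= => /andP[s0 sy].
  by rewrite /fr patchE mem_set//= in_itv/= s0 (lt_trans sy).
have dg := near_eq_derivable gF dF.
have gE' : g = (fun x => g x - g 0) \+ cst (g 0).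
  by apply/funext => x /=; rewrite subrK.
apply: nd; split.
  by rewrite gE'; exact: (derivableD dg (derivable_cst _ _ _)).
have <- : fr t = f t by rewrite /fr patchE mem_set//= in_itv/= t0.
rewrite -F' !derive1E gE' (deriveD dg (derivable_cst _ _ _)).
rewrite derive_cst addr0; apply/esym; exact: near_eq_derive gF.
Qed.

Lemma nondecreasing_derive1_ge0 g (t : R) :
  (forall x y, 0 <= x -> x <= y -> y <= 1 -> g x <= g y) ->
  0 < t < 1 -> derivable g t 1 -> 0 <= derive1 g t.
Proof.
move=> nd /andP[t0 t1] dg; rewrite derive1E; apply: limr_ge => //.
(* Such increments keep [h + t] in [0, 1], where [g] is known to be monotone; the difference
   quotient is then nonnegative for either sign of [h]. *)
have : \forall h \near (0 : R)^', `|h| < Num.min t (1 - t).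
  apply: dnbhs0_lt; rewrite lt_min t0 subr_gt0//.
apply: filterS => h; rewrite lt_min [h *: 1]mulr1 => /andP[].
rewrite !ltr_norml => ht h1t.
rewrite [X in _ <= X]/(h^-1 * (g (h + t) - g t)).
have [h0|h0] := leP 0 h.
  by rewrite mulr_ge0 ?invr_ge0// subr_ge0 nd//; lra.

by rewrite mulr_le0 ?invr_le0 ?(ltW h0)// subr_le0 nd//; lra.
Qed.

Lemma derive1_le_increment g1 g2 (t : R) :
  (forall x y, 0 <= x -> x <= y -> y <= 1 -> g1 y - g1 x <= g2 y - g2 x) ->
  0 < t < 1 -> derivable g1 t 1 -> derivable g2 t 1 ->
  derive1 g1 t <= derive1 g2 t.
Proof.
move=> le12 t01 d1 d2; rewrite -subr_ge0 !derive1E -(deriveB d2 d1) -derive1E.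
apply: (nondecreasing_derive1_ge0 _ t01 (derivableB d2 d1)) => x y x0 xy y1.
have := le12 x y x0 xy y1; rewrite !fctE.
by move: (g1 x) (g1 y) (g2 x) (g2 y) => a b c d; lra.
Qed.

Lemma lipschitz01_derivative g :
  (forall x y, 0 <= x -> x <= y -> y <= 1 -> 0 <= g y - g x <= y - x) ->
  exists f, [/\ unit_version (derive1 g) f,
    lambda.-negligible [set t | 0 < t < 1 /\ ~ derivable g t 1] &
    forall a b, 0 <= a -> a <= b -> b <= 1 ->
      \int[lambda]_(t in `]a, b[) f t = g b - g a].
Proof.
(* Only the values of [g] on [0, 1] are controlled; composing with the clamp [cl] gives a function
   that is monotone and 1-Lipschitz on the line. *)
move=> lip; pose cl x : R := Num.max 0 (Num.min 1 x).
have clE x : 0 <= x <= 1 -> cl x = x.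
  by move=> /andP[x0 x1]; rewrite /cl min_r// max_r.
have [x y xy|f0 [if0 f0E]] := @lipschitz_density (g \o cl).
  have cl01 z : 0 <= cl z <= 1.
    by rewrite /cl le_max lexx/= ge_max ler01 ge_min lexx.
  have clxy : cl x <= cl y <= cl x + (y - x).
    have clP z : [\/ z <= 0 /\ cl z = 0, 0 <= z <= 1 /\ cl z = z
        | 1 <= z /\ cl z = 1].
      have [z0|z0] := leP z 0.
        by constructor 1; rewrite /cl min_r ?max_l//; lra.
      have [z1|z1] := leP z 1.
        by constructor 2; rewrite clE ?(ltW z0).
      by constructor 3; rewrite /cl min_l ?max_r//; lra.
    by case: (clP x) => -[? ->]; case: (clP y) => -[? ->]; lra.
  have /andP[clx clxy'] := clxy.
  have /andP[x0 _] := cl01 x; have /andP[_ y1] := cl01 y.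
  have /= := lip (cl x) (cl y) x0 clx y1; lra.
have {}f0E x : 0 <= x <= 1 -> g x = g 0 + \int[lambda]_(t in `]0, x[) f0 t.
  by move=> x01; have := f0E x x01; rewrite /= !clE// lexx ler01.
have Nd := primitive_derivable if0 f0E.
pose f1 := f0 \_ `]0, 1[.
(* Truncation forces the bounds everywhere and changes nothing almost everywhere: where the
   derivative exists and equals [f0], it already lies in [0, 1]. *)
pose f t := Num.max 0 (Num.min 1 (f1 t)).
have mf : measurable_fun setT f.
  apply: measurable_maxr => //; apply: measurable_minr => //.
  apply/(measurable_restrictT _ _).1 => //.
  apply/measurable_EFinP; move: if0 => /measurable_int; exact.
have f01 t : 0 <= f t <= 1 by rewrite /f le_max lexx/= ge_max ler01 ge_min lexx.
have fE t : 0 < t < 1 -> derivable g t 1 -> derive1 g t = f0 t -> f t = f0 t.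
  move=> t01 dg gf.
  have g0 : 0 <= derive1 g t.
    apply: nondecreasing_derive1_ge0 => // x y x0 xy y1.
    by have := lip x y x0 xy y1; lra.
  have g1 : derive1 g t <= 1.
    rewrite -(derive1_id t).
    apply: (derive1_le_increment _ t01 dg); last exact: derivable_id.
    by move=> x y x0 xy y1; have /andP[] := lip x y x0 xy y1.
  rewrite /f /f1 patchE mem_set ?/= ?in_itv//= -gf min_r// max_r//.
exists f; split.
- split => //; apply: negligibleS Nd => t /= [t01 ne]; split => // -[dg gf].
  by apply: ne; rewrite (fE _ t01 dg).
- by apply: negligibleS Nd => t /= [t01 nd]; split => // -[].
move=> a b a0 ab b1.
have fint x : 0 <= x <= 1 -> g x = g 0 + \int[lambda]_(t in `]0, x[) f t.
  move=> x01; rewrite f0E//; congr (_ + fine _); apply: ae_eq_integral => //.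
  - apply: measurable_funS (measurable_int _ if0) => //.
    by apply: subset_itvl; rewrite bnd_simp; case/andP: x01.
  - exact/measurable_EFinP/measurable_funTS.
  - apply: negligibleS Nd => t /= /not_implyP[]; rewrite in_itv/= => tx ne.
    split; first lra.
    move=> [dg gf]; apply: ne; rewrite (fE t)//; lra.
have ifu u v : lambda.-integrable `]u, v[ (EFin \o f) by exact: integrable_unit.
move: ab; rewrite le_eqVlt => /predU1P[->|ab].
  by rewrite set_itvE Rintegral_set0 subrr.
have a01 : 0 <= a <= 1 by lra.
have b01 : 0 <= b <= 1 by lra.
have := @Rintegral_itvB R f (BRight 0) (BLeft b) a (ifu _ _).
rewrite !bnd_simp => /(_ a0 ab) <-; rewrite -Rintegral_itv_bndo_bndc//.
by rewrite (fint _ a01) (fint _ b01); lra.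
Qed.

(** * The copula [rearranged C] *)

Lemma copula_lipschitz C v : copula C -> 0 <= v <= 1 ->
  forall x y, 0 <= x -> x <= y -> y <= 1 -> 0 <= C y v - C x v <= y - x.
Proof.
move=> [_ C0 C1 C2] /andP[v0 v1] x y x0 xy y1.
have x01 : 0 <= x <= 1 by lra.
have y01 : 0 <= y <= 1 by lra.
have [Cx0 _] := C0 x x01; have [Cy0 _] := C0 y y01.
have [Cx1 _] := C1 x x01; have [Cy1 _] := C1 y y01.
(* The rectangle below height [v] gives monotonicity through groundedness; the one above gives the
   Lipschitz bound through the uniform marginal. *)
have := C2 x y 0 v x0 xy y1 (lexx 0) v0 v1.
have := C2 x y v 1 x0 xy y1 v0 v1 (lexx 1).
lra.
Qed.

Lemma rearr_int0 h : rearr_int h 0 = 0.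
Proof.
rewrite /rearr_int (_ : (fun _ => _) = cst 0) ?Rintegral_cst ?mul0r//.
by apply/funext => w; rewrite min_l//; have /andP[] := tail_bounds h w.
Qed.

Lemma rearr_int_le h x : 0 <= x <= 1 -> rearr_int h x <= x.
Proof.
move=> x01.
have xE : \int[lambda]_(w in `[0, 1]) cst x w = x.
  rewrite Rintegral_cst//= lebesgue_measure_itv/= lte_fin ltr01.
  by rewrite oppr0 adde0 mulr1.
rewrite -[leRHS]xE; apply: le_Rintegral => //; first exact: integrable_min_tail.
- apply: measurable_bounded_integrable => //.
    by rewrite /= lebesgue_measure_itv/=; case: ifP => _; rewrite -?EFinB ltry.
  exact: bounded_cst.
- by move=> w _ /=; rewrite ge_min lexx.
Qed.

Lemma rearr_int_homo h x y : 0 <= x -> x <= y -> y <= 1 ->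
  rearr_int h x <= rearr_int h y.
Proof.
move=> x0 xy y1; apply: le_Rintegral => //; try (apply: integrable_min_tail; lra).
by move=> w _; rewrite le_min !ge_min lexx xy orbT.
Qed.

(* The copula [C_up]; [C_down] is [flip (rearranged C)], where [flip] reverses
   the first coordinate. *)
Definition rearranged C (u v : R) : R := rearr_int (partial1 C ^~ v) u.

Lemma copula_partial1 C v : copula C -> 0 <= v <= 1 ->
  exists f, [/\ unit_version (partial1 C ^~ v) f,
    lambda.-negligible [set t | 0 < t < 1 /\ ~ derivable (C ^~ v) t 1] &
    forall a b, 0 <= a -> a <= b -> b <= 1 ->
      \int[lambda]_(t in `]a, b[) f t = C b v - C a v].
Proof. by move=> cC v01; exact/lipschitz01_derivative/copula_lipschitz. Qed.

Lemma rearranged1 C v : copula C -> 0 <= v <= 1 -> rearranged C 1 v = v.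
Proof.
move=> cC v01; have [f [vf _ fE]] := copula_partial1 cC v01.
rewrite /rearranged (rearr_int1 vf) fE//.
by case: cC => _ /(_ v v01)[_ ->] /(_ v v01)[_ ->] _; rewrite subr0.
Qed.

Lemma le_rearranged C u v : copula C -> 0 <= u <= 1 -> 0 <= v <= 1 ->
  C u v <= rearranged C u v.
Proof.
move=> cC /andP[u0 u1] v01; have [f [vf _ fE]] := copula_partial1 cC v01.
have := int_le_rearr_int vf (lexx 0) u0 u1; rewrite fE// subr0.
by case: cC => _ /(_ v v01)[_ ->] _ _; rewrite subr0.
Qed.

(** Since [C] is 2-increasing, the section at [v2] grows at least as fast as the one at [v1], so the
    derivatives are ordered wherever both exist. *)
Lemma tail_partial1_homo C v1 v2 w : copula C -> 0 <= v1 -> v1 <= v2 -> v2 <= 1 ->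
  tail (partial1 C ^~ v1) w <= tail (partial1 C ^~ v2) w.
Proof.
move=> cC v10 v12 v21; apply: le_tail_negligible.
have [|_ [_ N1 _]] := @copula_partial1 C v1 cC; first lra.
have [|_ [_ N2 _]] := @copula_partial1 C v2 cC; first lra.
apply: negligibleS (negligibleU N1 N2) => t /= [t01 h21].
have [d1|nd1] := pselect (derivable (C ^~ v1) t 1); last first.
  by left; split; [exact: t01|exact: nd1].
have [d2|nd2] := pselect (derivable (C ^~ v2) t 1); last first.
  by right; split; [exact: t01|exact: nd2].
exfalso; move: h21; apply/negP; rewrite -leNgt.
apply: (derive1_le_increment _ t01 d1 d2) => x y x0 xy y1.
case: cC => _ _ _ /(_ x y v1 v2 x0 xy y1 v10 v12 v21).
move: (C y v2) (C y v1) (C x v2) (C x v1) => a b c d; lra.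
Qed.

Lemma copula_rearranged C : copula C -> copula (rearranged C).
Proof.
move=> cC; have incr2 u1 u2 v1 v2 : 0 <= u1 -> u1 <= u2 -> u2 <= 1 ->
    0 <= v1 -> v1 <= v2 -> v2 <= 1 ->
    0 <= rearranged C u2 v2 - rearranged C u2 v1
         - rearranged C u1 v2 + rearranged C u1 v1.
  move=> u10 u12 u21 v10 v12 v21.
  have : rearranged C u2 v1 - rearranged C u1 v1 <=
      rearranged C u2 v2 - rearranged C u1 v2.
    exact: (rearr_int_mono2 u10 u12 u21
      (fun w => tail_partial1_homo w cC v10 v12 v21)).
  move: (rearranged C u2 v2) (rearranged C u2 v1) (rearranged C u1 v2).
  by move: (rearranged C u1 v1) => a b c d; lra.
have rearr0 v : rearranged C 0 v = 0 by exact: rearr_int0.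
have rearr_le u v : 0 <= u <= 1 -> 0 <= v <= 1 -> 0 <= rearranged C u v <= v.
  move=> /andP[u0 u1] v01; apply/andP; split.
    by rewrite -(rearr0 v); exact: rearr_int_homo.
  by rewrite -[leRHS](rearranged1 cC v01); exact: rearr_int_homo.
split => //.
- move=> u v u01 v01; have /andP[-> /le_trans] := rearr_le u v u01 v01.
  by apply; case/andP: v01.
- move=> t t01; split => //; apply/eqP.
  by rewrite eq_le andbC; apply: rearr_le; rewrite ?lexx ?ler01.
- move=> t t01; have i1 : 0 <= (1 : R) <= 1 by rewrite lexx ler01.
  split; last exact: rearranged1.
  (* The other inequality comes from [C t 1 = t] and the domination of [C] by [rearranged C]. *)
  apply/eqP; rewrite eq_le rearr_int_le//=.
  have := le_rearranged cC t01 i1.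
  by case: cC => _ _ /(_ t t01)[-> _].
Qed.

(** The section of [rearranged C] at [v] is a primitive of a decreasing rearrangement [fs], so its
    derivative is almost everywhere [fs], which has the original distribution. *)
Lemma tail_rearranged C v : copula C -> 0 <= v <= 1 ->
  tail (partial1 (rearranged C) ^~ v) = tail (partial1 C ^~ v).
Proof.
move=> cC v01; have [f [vf _ _]] := copula_partial1 cC v01.
have [hs dh] := decr_rearr_exists vf.
have [fs [mfs fs01 fs_ni fsE]] := decr_rearr_borel vf dh.
rewrite -(tail_decr_rearr dh) -(eq_tail fsE).
apply: tail_version; split => //.
have Nd : lambda.-negligible [set t | 0 < t < 1 /\
    ~ (derivable (rearranged C ^~ v) t 1 /\ derive1 (rearranged C ^~ v) t = fs t)].
  apply: primitive_derivable; first exact: integrable_unit.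
  move=> x x01; rewrite /rearranged rearr_int0 add0r int_nonincreasing//.
  by rewrite /rearr_int (eq_tail fsE) (tail_decr_rearr dh).
by apply: negligibleS Nd => t /= [t01 ne]; split => // -[_ /ne].
Qed.

(** * Comparison of orders and the greatest element *)

Lemma le_d1SP D E : copula D -> copula E -> le_d1S D E <->
  (forall u v, 0 < u < 1 -> 0 < v < 1 -> rearranged D u v <= rearranged E u v).
Proof.
move=> cD cE.
have H v : 0 < v < 1 -> schur_le (partial1 D ^~ v) (partial1 E ^~ v) <->
    (forall u, 0 < u < 1 -> rearranged D u v <= rearranged E u v).
  move=> v01; have v01' : 0 <= v <= 1 by lra.
  have [f [vf _ _]] := copula_partial1 cD v01'.
  have [g [vg _ _]] := copula_partial1 cE v01'.
  apply: iff_trans (schur_leP vf vg) _; split => [[le _]|le]; first exact: le.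
  split; first exact: le.
  (* Both total integrals equal [v], by the marginals. *)
  by rewrite [LHS](rearranged1 cD v01') [RHS](rearranged1 cE v01').
split=> [le u v u01 v01|le v v01]; first exact: (H v v01).1 (le v v01) u u01.
by apply: (H v v01).2 => u u01; exact: le.
Qed.

(** On the boundary of the square all copulas agree. *)
Lemma le_lo_interior D E : copula D -> copula E ->
  (forall u v, 0 < u < 1 -> 0 < v < 1 -> D u v <= E u v) -> le_lo D E.
Proof.
move=> [_ D0 D1 _] [_ E0 E1 _] le u v u01 v01.
have [->|u_neq0] := eqVneq u 0; first by rewrite (D0 v v01).2 (E0 v v01).2.
have [->|u_neq1] := eqVneq u 1; first by rewrite (D1 v v01).2 (E1 v v01).2.
have [->|v_neq0] := eqVneq v 0; first by rewrite (D0 u u01).1 (E0 u u01).1.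
have [->|v_neq1] := eqVneq v 1; first by rewrite (D1 u u01).1 (E1 u u01).1.
by apply: le; rewrite !lt_neqAle ?(eq_sym 0) ?u_neq0 ?u_neq1 ?v_neq0 ?v_neq1.
Qed.

Lemma le_d1S_le_lo D E : copula D -> copula E ->
  le_d1S D E <-> le_lo (rearranged D) (rearranged E).
Proof.
move=> cD cE; apply: iff_trans (le_d1SP cD cE) _; split => [le|le u v].
  exact: le_lo_interior (copula_rearranged cD) (copula_rearranged cE) le.
by move=> /andP[u0 u1] /andP[v0 v1]; apply: le; rewrite ltW ?ltW.
Qed.

Lemma eq_tail_le_d1S C C' E : copula C -> copula C' -> copula E ->
  (forall v, 0 <= v <= 1 -> tail (partial1 C ^~ v) = tail (partial1 C' ^~ v)) ->
  le_d1S C E -> le_d1S C' E.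
Proof.
move=> cC cC' cE CC' /(le_d1SP cC cE) le.
apply: (le_d1SP cC' cE).2 => u v u01 /andP[v0 v1].
have := le u v u01; rewrite v0 v1 => /(_ isT).
by rewrite /rearranged /rearr_int CC' // !ltW.
Qed.

Lemma copulas_below_refl E : copula E -> copulas_below E E.
Proof. by move=> cE; split => //; exact: (le_d1SP cE cE).2. Qed.

Lemma copulas_below_rearranged E : copula E -> copulas_below E (rearranged E).
Proof.
move=> cE; have [_ EE] := copulas_below_refl cE.
split; first exact: copula_rearranged.
apply: (eq_tail_le_d1S cE (copula_rearranged cE) cE _ EE) => v v01.
exact/esym/tail_rearranged.
Qed.

(** The chain is [C], then [rearranged C], then [rearranged E]. *)
Lemma rearranged_greatest E C : copula E -> copulas_below E C ->
  le_lo C (rearranged E).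
Proof.
move=> cE [cC /(le_d1S_le_lo cC cE) CE] u v u01 v01.
exact: le_trans (le_rearranged cC u01 v01) (CE _ _ u01 v01).
Qed.

Lemma rearr_upE E u v : copula E -> 0 <= u <= 1 -> 0 <= v <= 1 ->
  rearr_up E u v = rearranged E u v.
Proof.
move=> cE u01 v01; have brearr := copulas_below_rearranged cE.
have [bM Mmax] : copulas_below E (rearr_up E) /\
    forall C, copulas_below E C -> le_lo C (rearr_up E).
  apply: (@xgetPex _ E [set M | copulas_below E M /\
    forall C, copulas_below E C -> le_lo C M]).
  by exists (rearranged E); split => [//|C]; exact: rearranged_greatest.
apply/eqP; rewrite eq_le (Mmax _ brearr _ _ u01 v01) andbT.
exact: rearranged_greatest bM _ _ u01 v01.
Qed.

(** * Reflection of the first coordinate and the least element *)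

(** If [C] is the distribution function of (U, V), this is that of (1 - U, V). *)
Definition flip C (u v : R) : R := v - C (1 - u) v.

Lemma copula_flip C : copula C -> copula (flip C).
Proof.
move=> cC; have [C01 C0 C1 C2] := cC; split.
- move=> u v u01 v01; have u01' : 0 <= 1 - u <= 1 by lra.
  have := C01 _ _ u01' v01; have := copula_lipschitz cC v01.
  have /andP[a b] := u01'.
  move=> /(_ _ 1 a b (lexx 1)); rewrite (C1 v v01).2 /flip.
  lra.
- move=> t t01; have t01' : 0 <= 1 - t <= 1 by lra.
  by rewrite /flip (C0 _ t01').1 !subr0 (C1 _ t01).2 subrr.
- move=> t t01; have t01' : 0 <= 1 - t <= 1 by lra.
  rewrite /flip (C1 _ t01').1 subrr (C0 _ t01).2; lra.
- move=> u1 u2 v1 v2 u10 u12 u21 v10 v12 v21.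
  have : 0 <= C (1 - u1) v2 - C (1 - u1) v1 - C (1 - u2) v2 + C (1 - u2) v1.
    by apply: C2 => //; lra.
  rewrite /flip; lra.
Qed.

Definition refl01 (t : R) : R := 1 - t.

Lemma is_derive_refl01 (t : R) : is_derive t (1 : R) refl01 (-1).
Proof.
have -> : refl01 = cst 1 - id by apply/funext.
by rewrite -[-1]sub0r; exact: is_deriveB.
Qed.

Lemma measurable_refl01 (A : set R) : measurable A -> measurable (refl01 @^-1` A).
Proof.
move=> mA; rewrite -[_ @^-1` _]setTI.
have : measurable_fun setT refl01 by exact: measurable_funB.
exact.
Qed.

(** The image of the Lebesgue measure under the reflection gives half-open intervals their length,
    so uniqueness applies. *)
Lemma lambda_refl01 (A : set R) : measurable A ->
  lambda (refl01 @^-1` A) = lambda A.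
Proof.
move=> mA.
have mo : @measurable_fun _ _ (measurableTypeR R) (measurableTypeR R) setT refl01.
  exact: measurable_funB.
pose o : {mfun measurableTypeR R >-> measurableTypeR R} :=
  @mfun_Sub _ _ (measurableTypeR R) (measurableTypeR R) refl01 (mem_set mo).
apply/esym; apply: (@lebesgue_measure_unique _ (pushforward lambda o)) => //.
move=> _ [[a b] _ <-]; rewrite /pushforward.
rewrite [RHS](_ : _ = lambda `[1 - b, 1 - a[); last first.
  congr (lambda _); apply/seteqP; split => t; rewrite /= /refl01 !in_itv/=; lra.
rewrite !lebesgue_measure_itv/= !lte_fin ltrD2l ltrN2.
by case: ifP => //; rewrite -!EFinB => _; congr _%:E; lra.
Qed.

Lemma negligible_refl01 (N : set R) : lambda.-negligible N ->
  lambda.-negligible (refl01 @^-1` N).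
Proof.
move=> [M [mM M0 NM]]; exists (refl01 @^-1` M); split.
- exact: measurable_refl01.
- by rewrite [LHS]lambda_refl01.
- by move=> t /NM.
Qed.

Lemma tail_refl01 f : measurable_fun setT f -> tail (f \o refl01) = tail f.
Proof.
move=> mf; apply/funext => w; rewrite /tail; congr fine.
rewrite -[RHS]lambda_refl01; last exact: measurable_superlevel.
by congr (lambda _); apply/seteqP; split => t /= [t01 wf]; split => //;
  rewrite /refl01 in t01 *; lra.
Qed.

(** By the chain rule the two minus signs cancel: the derivative of [flip C] at [t] is that of [C]
    at [1 - t], and reflection preserves distributions. *)
Lemma tail_flip C v : copula C -> 0 <= v <= 1 ->
  tail (partial1 (flip C) ^~ v) = tail (partial1 C ^~ v).
Proof.
move=> cC v01; have [f [vf Nd _]] := copula_partial1 cC v01.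
have [mf f01 Nf] := vf; rewrite (tail_version vf) -(tail_refl01 mf).
apply: tail_version; split => //.
    by apply: measurableT_comp => //; exact: measurable_funB.
  by move=> t; exact: f01.
have N := negligible_refl01 (negligibleU Nd Nf).
apply: (negligibleS _ N) => t /= [t01 ne].
have ot01 : 0 < refl01 t < 1 by rewrite /refl01; lra.
have [dC|] := pselect (derivable (C ^~ v) (refl01 t) 1); last by left.
right; split => //; apply: contra_not ne => <-.
have -> : partial1 (flip C) t v = derive1 (cst v - ((C ^~ v) \o refl01)) t by [].
have [dr dE] := is_derive_refl01 t.
have dCo : derivable ((C ^~ v) \o refl01) t 1.
  apply/derivable1_diffP.
  exact: (differentiable_comp ((derivable1_diffP _ _).1 dr)
    ((derivable1_diffP _ _).1 dC)).
rewrite derive1E (deriveB (derivable_cst _ _ _) dCo) derive_cst sub0r.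
by rewrite -derive1E (derive1_comp dr dC) (derive1E refl01) dE mulrN1 opprK.
Qed.

Lemma flip_copulas_below E C : copula E -> copulas_below E C ->
  copulas_below E (flip C).
Proof.
move=> cE [cC CE]; have cF := copula_flip cC; split; first exact: cF.
by apply: (eq_tail_le_d1S cC cF cE _ CE) => v v01; exact/esym/tail_flip.
Qed.

(** On the square, [flip] is an order-reversing involution that preserves [copulas_below E], so it
    carries the greatest element to the least. *)
Lemma rearr_downE E u v : copula E -> 0 <= u <= 1 -> 0 <= v <= 1 ->
  rearr_down E u v = v - rearranged E (1 - u) v.
Proof.
move=> cE u01 v01; rewrite -/(flip (rearranged E) u v).
have least C : copulas_below E C -> le_lo (flip (rearranged E)) C.
  move=> /(flip_copulas_below cE) /(rearranged_greatest cE) le x y x01 y01.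
  have x01' : 0 <= 1 - x <= 1 by lra.
  have := le _ _ x01' y01; rewrite /flip subKr.
  by move: (C x y) (rearranged E (1 - x) y) => a b; lra.
have bdown := flip_copulas_below cE (copulas_below_rearranged cE).
have [bM Mmin] : copulas_below E (rearr_down E) /\
    forall C, copulas_below E C -> le_lo (rearr_down E) C.
  apply: (@xgetPex _ E [set M | copulas_below E M /\
    forall C, copulas_below E C -> le_lo M C]).
  by exists (flip (rearranged E)).
apply/eqP; rewrite eq_le (Mmin _ bdown _ _ u01 v01)/=.
exact: least bM _ _ u01 v01.
Qed.

End RearrangedCopulas.

Theorem proposition3p1 (R : realType) (D E : R -> R -> R)
    (hD : copula D) (hE : copula E) :
  [<-> le_d1S D E;
       le_lo (rearr_up D) (rearr_up E);
       le_lo (rearr_down E) (rearr_down D)].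
Proof.
have onem01 (u : R) : (0 <= u <= 1 -> 0 <= 1 - u <= 1)%R by lra.
split; last split.
- move=> /(le_d1S_le_lo hD hE) le u v u01 v01.
  by rewrite (rearr_upE hD u01 v01) (rearr_upE hE u01 v01); exact: le.
- move=> le u v u01 v01; have u01' := onem01 u u01.
  rewrite (rearr_downE hD u01 v01) (rearr_downE hE u01 v01).
  rewrite Num.Theory.lerD2l Num.Theory.lerN2.
  by rewrite -(rearr_upE hD u01' v01) -(rearr_upE hE u01' v01); exact: le.
- move=> le; apply: (le_d1S_le_lo hD hE).2 => u v u01 v01.
  (* Evaluating the least elements at [1 - u] recovers the values of [rearranged] at [u]. *)
  have u01' := onem01 u u01; have := le _ _ u01' v01.
  rewrite (rearr_downE hD u01' v01) (rearr_downE hE u01' v01).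
  by rewrite Num.Theory.lerD2l Num.Theory.lerN2 GRing.Theory.subKr.
Qed.
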